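(* Let $I\subset\mathbb{R}$ be an interval, let $a,b\in I$ with $a<b$, and let $f:I\to\mathbb{R}$ be differentiable on the interior $I^{\circ}$ of $I$ and at every point of $[a,b]$ (one-sided derivatives being used at a point of $[a,b]$ that is an endpoint of $I$), with $f'\in L[a,b]$. Let $q\ge 1$, let $c>0$, and suppose that $|f'|^q$ is strongly convex on $[a,b]$ with modulus $c$ and that $|f'(u)|\le M$ for all $u\in[a,b]$. Let $x\in[a,b]$ be such that $M^q\ge \max\left\{\frac{c(x-a)^2}{6},\frac{c(b-x)^2}{6}\right\}$. Then $$\left| f(x)-\frac{1}{b-a}\int_a^b f(u)\,du\right| \le \frac{(x-a)^2}{2(b-a)}\left(M^q-\frac{c(x-a)^2}{6}\right)^{\frac1q}+\frac{(b-x)^2}{2(b-a)}\left(M^q-\frac{c(b-x)^2}{6}\right)^{\frac1q}.$$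
   Context: A function $h:J\to\mathbb{R}$ on an interval $J$ is called strongly convex with modulus $c>0$ if $h(tx+(1-t)y)\le t h(x)+(1-t)h(y)-ct(1-t)(x-y)^2$ for all $x,y\in J$ and $t\in(0,1)$. $L[a,b]$ denotes the space of Lebesgue integrable functions on $[a,b]$. *)

(* Defs.v *)
From HB Require Import structures.
From mathcomp Require Import all_boot all_order all_algebra.
From mathcomp Require Import all_classical all_reals all_analysis.
Set Implicit Arguments.
Unset Strict Implicit.
Unset Printing Implicit Defensive.
Import Order.TTheory GRing.Theory Num.Theory.
Import numFieldNormedType.Exports.
Local Open Scope classical_set_scope.
Local Open Scope ring_scope.

(* Derivative at u of a function considered on the set A only: the increments h
   are restricted to h <> 0 with h + u in A. On an interval A this is the usual
   derivative at interior points and the one-sided derivative at an endpoint of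
   A (see the lemmas below). *)
Definition derivable_on (R : realType) (A : set R) (f : R -> R) (u : R) : Prop :=
  cvg ((fun h => h^-1 * (f (h + u) - f u)) @ within [set h | A (h + u)] 0^').

Definition derive_on (R : realType) (A : set R) (f : R -> R) (u : R) : R :=
  lim ((fun h => h^-1 * (f (h + u) - f u)) @ within [set h | A (h + u)] 0^').

Definition strongly_convex (R : realType) (J : set R) (c : R) (h : R -> R) : Prop :=
  forall x y t : R, J x -> J y -> 0 < t < 1 ->
    h (t * x + (1 - t) * y) <=
    t * h x + (1 - t) * h y - c * t * (1 - t) * (x - y) ^+ 2.

Section derive_on_lemmas.
Variables (R : realType) (A : set R) (f : R -> R) (u : R).

Let near_shift (P : set R) : (\forall y \near u, P y) ->
  \forall h \near (0 : R), P (h + u).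
Proof.
move=> /nbhs_ballP[e /= e0 eP]; apply/nbhs_ballP; exists e => //= h.
rewrite /ball/= sub0r normrN => he; apply: eP.
by rewrite /ball/= opprD addrCA subrr addr0 normrN.
Qed.

Let within_inc (B : set R) :
  (\forall y \near u, y != u -> A y <-> B (y - u)) ->
  within [set h | A (h + u)] 0^' = within B 0^'.
Proof.
move=> /near_shift H.
by apply/seteqP; split => S; rewrite /within/= /dnbhs/within/= => HS;
  apply: filterS2 H HS => h AB hS h0;
  move: AB; rewrite addrK -subr_eq0 addrK => /(_ h0) AB /AB; apply: hS.
Qed.

Let shiftE : (fun h => h^-1 *: ((f \o shift u) (h *: 1) - f u)) =
             (fun h : R => h^-1 * (f (h + u) - f u)).
Proof. by apply/funext => h /=; rewrite /shift/= /GRing.scale/= mulr1. Qed.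

Let within_interiorE : A° u -> within [set h | A (h + u)] 0^' = 0^'.
Proof.
move=> Au; rewrite (@within_inc setT); last first.
  by near=> y => _; split => // _; near: y.
by apply/seteqP; split => S; rewrite /within/=; apply: filterS => // h; apply.
Unshelve. all: by end_near. Qed.

Lemma derivable_on_interior : A° u -> derivable_on A f u <-> derivable f u 1.
Proof.
by move=> Au; rewrite /derivable_on /derivable shiftE within_interiorE.
Qed.

Lemma derive_on_interior : A° u -> derive_on A f u = f^`()%classic u.
Proof. by move=> Au; rewrite derive1E /derive_on /derive shiftE within_interiorE. Qed.

Let within_lr (B : set R) : within (B `\ 0) (nbhs (0 : R)) = within B 0^'.
Proof.
apply/seteqP; split => S.
  change ((\forall h \near (0 : R), (B `\ 0) h -> S h) ->
          \forall h \near (0 : R), h != 0 -> B h -> S h).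
  by apply: filterS => h H /eqP h0 Bh; apply: H.
change ((\forall h \near (0 : R), h != 0 -> B h -> S h) ->
        \forall h \near (0 : R), (B `\ 0) h -> S h).
by apply: filterS => h H [Bh /eqP h0]; apply: H.
Qed.

Lemma derive_on_left_endpoint : (forall y, A y -> u <= y) ->
  (\forall y \near u^'+, A y) ->
  derive_on A f u = lim ((fun h => h^-1 * (f (h + u) - f u)) @ 0^'+).
Proof.
move=> uA Au; rewrite /derive_on (@within_inc [set h | 0 < h]); last first.
  near=> y => yu; rewrite /= subr_gt0; split => [/uA uy|uy].
    by rewrite lt_neqAle eq_sym yu.
  by move: uy; near: y; exact: Au.
suff -> : 0^'+ = within [set h : R | 0 < h] 0^' by [].
suff E : [set h : R | 0 < h] `\ 0 = [set h : R | 0 < h] by rewrite -within_lr E.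
by apply/seteqP; split => h /=; [case|move=> h0; split => // /eqP; rewrite gt_eqF].
Unshelve. all: by end_near. Qed.

Lemma derive_on_right_endpoint : (forall y, A y -> y <= u) ->
  (\forall y \near u^'-, A y) ->
  derive_on A f u = lim ((fun h => h^-1 * (f (h + u) - f u)) @ 0^'-).
Proof.
move=> uA Au; rewrite /derive_on (@within_inc [set h | h < 0]); last first.
  near=> y => yu; rewrite /= subr_lt0; split => [/uA uy|uy].
    by rewrite lt_neqAle yu.
  by move: uy; near: y; exact: Au.
suff -> : 0^'- = within [set h : R | h < 0] 0^' by [].
suff E : [set h : R | h < 0] `\ 0 = [set h : R | h < 0] by rewrite -within_lr E.
by apply/seteqP; split => h /=; [case|move=> h0; split => // /eqP; rewrite lt_eqF].
Unshelve. all: by end_near. Qed.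

End derive_on_lemmas.

(* Main.v *)
(* For e an endpoint of [a, b], strong convexity along the segment from e to x
   gives |f'(u)|^q <= M^q - c (u - e)(x - u), a quadratic in u whose mean against
   the weight |u - e| is m = M^q - c (x - e)^2 / 6.  Replacing the concave power
   y |-> y^(1/q) by its tangent at m bounds |f'| by a quadratic polynomial P, so
   that |f(u) - f(x)| is bounded by a cubic by monotonicity of the cubic plus or
   minus f.  Integrating the cubic between e and x yields exactly
   (x - e)^2 / 2 * m^(1/q): the tangent is chosen at the mean, so its linear term
   does not contribute, and no integration of f' is needed. *)
Require Import Defs.
From HB Require Import structures.
From mathcomp Require Import all_boot all_order all_algebra.
From mathcomp Require Import all_classical all_reals all_analysis.
From mathcomp Require Import ring lra.
Set Implicit Arguments.
Unset Strict Implicit.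
Unset Printing Implicit Defensive.
Import Order.TTheory GRing.Theory Num.Theory.
Import numFieldNormedType.Exports.
Local Open Scope classical_set_scope.
Local Open Scope ring_scope.

(** * Tangent bounds for concave powers *)

(** Bernoulli's inequality, from [expR v >= 1 + v] at [v = ln s - z] and [v = - z], where
    [z = p * ln s]: the weights [p] and [1 - p] make the first-order terms cancel. *)
Lemma powR_le_tangent1 (R : realType) (p s : R) : 0 <= p <= 1 -> 0 <= s ->
  s `^ p <= 1 + p * (s - 1).
Proof.
move=> /andP[p0 p1]; rewrite le_eqVlt => /predU1P[<-|s0].
  (* Since [powR] gives 0 to the power 0 the value 1, the case [p = 0] is separate: both sides equal
     1. *)
  have [->|pN0] := eqVneq p 0; first by rewrite powRr0; lra.
  by rewrite powR0//; lra.
rewrite /powR gt_eqF//; set z := p * ln s; set E := expR z.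
have E0 : 0 < E by exact: expR_gt0.
have h1 : E * (1 + (ln s - z)) <= s.
  have {2}-> : s = E * expR (ln s - z).
    by rewrite -expRD addrCA subrr addr0 lnK// posrE.
  by rewrite ler_pM2l// expR_ge1Dx.
have h2 : E * (1 - z) <= 1.
  have {2}-> : 1 = E * expR (- z) by rewrite -expRD subrr expR0.
  by rewrite ler_pM2l// expR_ge1Dx.
have h1' := ler_wpM2l p0 h1.
have h2' : (1 - p) * (E * (1 - z)) <= (1 - p) * 1 by apply: ler_wpM2l => //; lra.
have : p * (E * (1 + (ln s - z))) + (1 - p) * (E * (1 - z)) = E.
  by rewrite /z; ring.
lra.
Qed.

(** Homogeneity reduces the tangent at [m] to the tangent at 1, taken at [y / m]. *)
Lemma powR_le_tangent (R : realType) (p m y : R) :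
  0 <= p <= 1 -> 0 < m -> 0 <= y ->
  y `^ p <= m `^ p + p * m `^ p / m * (y - m).
Proof.
move=> p01 m0 y0.
have -> : m `^ p + p * m `^ p / m * (y - m) = (1 + p * (y / m - 1)) * m `^ p.
  by field; rewrite gt_eqF.
have -> : y `^ p = (y / m) `^ p * m `^ p.
  by rewrite -powRM ?divfK ?gt_eqF//; [exact: divr_ge0 (ltW m0)|exact: ltW].
by rewrite ler_wpM2r ?powR_ge0// powR_le_tangent1// divr_ge0// ltW.
Qed.

(** * Continuity and increments from the derivative *)

(** The increment of [f] is [h] times a convergent quotient, hence tends to 0. *)
Lemma derivable_on_continuous (R : realType) (A : set R) (f : R -> R) (u : R) :
  derivable_on A f u -> f @ within A (nbhs u) --> f u.
Proof.
move=> /cvg_ex[/= l fl].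
have h0 : (fun h : R => h) @ within [set h | A (h + u)] 0^' --> (0 : R).
  by do 2 apply: cvg_within_filter; exact: cvg_id.
have /= := cvgM h0 fl; rewrite mul0r => /(_ _) /cvgrPdist_lt H.
apply/cvgrPdist_lt => e e0; have {H} := H e e0.
rewrite /dnbhs /within /= => /nbhs_ballP[d /= d0 dP].
apply/nbhs_ballP; exists d => //= y uy Ay.
have [->|yu] := eqVneq y u; first by rewrite subrr normr0.
have yu0 : y - u != 0 by rewrite subr_eq0.
have := dP (y - u); rewrite /ball /= sub0r opprB => /(_ uy yu0).
rewrite subrK => /(_ Ay).
by rewrite /= sub0r normrN mulrA divff// mul1r distrC.
Qed.

(** Both [W - f] and [W + f] are nondecreasing: their derivatives are nonnegative inside and they
    are continuous up to the ends. *)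
Lemma increment_le (R : realType) (f W w : R -> R) (l r : R) :
  {within `[l, r], continuous f} ->
  (forall u, u \in `]l, r[ -> derivable f u 1) ->
  (forall u : R, is_derive u 1 W (w u)) ->
  (forall u, u \in `]l, r[ -> `|f^`()%classic u| <= w u) ->
  {in `[l, r] &, forall u v, u <= v -> `|f v - f u| <= W v - W u}.
Proof.
move=> cf df dW fw u v ulr vlr uv.
have cW : {within `[l, r], continuous W}.
  by apply: derivable_within_continuous => z _; exact: ex_derive.
have dfz z : z \in `]l, r[ -> is_derive z 1 f (f^`()%classic z).
  by move=> zlr; rewrite derive1E; apply/derivableP/df.
have H1 : W u - f u <= W v - f v.
  apply: (@ger0_derive1_le_cc _ (W - f) l r) => // z zlr.
  + by have := dfz z zlr => ?; exact: ex_derive.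
  + have ? := dfz z zlr; rewrite derive1E derive_val subr_ge0.
    by have := fw z zlr; rewrite ler_norml => /andP[].
  + by apply: cvgB; [exact: cW|exact: cf].
have H2 : W u + f u <= W v + f v.
  apply: (@ger0_derive1_le_cc _ (W + f) l r) => // z zlr.
  + by have := dfz z zlr => ?; exact: ex_derive.
  + have ? := dfz z zlr; rewrite derive1E derive_val.
    by have := fw z zlr; rewrite ler_norml => /andP[]; lra.
  + by apply: cvgD; [exact: cW|exact: cf].
by rewrite ler_norml; apply/andP; split; lra.
Qed.

(** * Integral estimates on a segment *)

Lemma Rintegral_FTC2 (R : realType) (F g : R -> R) (l r : R) : l <= r ->
  continuous g -> (forall u : R, is_derive u 1 F (g u)) ->
  \int[@lebesgue_measure R]_(u in `[l, r]) g u = F r - F l.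
Proof.
rewrite le_eqVlt => /predU1P[<- _ _|lr cg dF].
  by rewrite set_itv1 Rintegral_set1 subrr.
have cF z : {for z, continuous F}.
  by apply/differentiable_continuous/derivable1_diffP; exact: ex_derive.
rewrite /Rintegral (@continuous_FTC2 _ _ F)//.
- exact: continuous_subspaceT.
- split=> [z _||]; first exact: ex_derive.
  + by apply: cvg_at_right_filter; exact: cF.
  + by apply: cvg_at_left_filter; exact: cF.
- by move=> z _; rewrite derive1E derive_val.
Qed.

Lemma Rintegral_dist_le (R : realType) (f V W : R -> R) (l r A : R) : l <= r ->
  {within `[l, r], continuous f} ->
  continuous W -> (forall u : R, is_derive u 1 V (W u)) ->
  (forall u, u \in `[l, r] -> `|f u - A| <= W u) ->
  `|\int[@lebesgue_measure R]_(u in `[l, r]) f u - A * (r - l)| <= V r - V l.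
Proof.
move=> lr cf cW dV fW.
have integ g : {within `[l, r], continuous g} ->
    (@lebesgue_measure R).-integrable `[l, r] (EFin \o g).
  by apply: continuous_compact_integrable; exact: segment_compact.
(* The sign [s = -1] or [s = 1] selects the lower envelope [A - W] or the upper envelope [A + W] of
   [f]. *)
have bound (s : R) : \int[@lebesgue_measure R]_(u in `[l, r]) (A + s * W u) =
    A * (r - l) + s * (V r - V l).
  have cg : continuous (fun u => A + s * W u).
    by move=> u; apply: cvgD; [exact: cvg_cst|apply: cvgMr; exact: cW].
  have dG (u : R) : is_derive u 1 (fun v => A * v + s * V v) (A + s * W u).
    by apply: is_derive_eq; rewrite /GRing.scale /=; ring.
  by rewrite (Rintegral_FTC2 lr cg dG); ring.
have cAW (s : R) : {within `[l, r], continuous (fun u => A + s * W u)}.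
  by apply: continuous_subspaceT => u; apply: cvgD;
    [exact: cvg_cst|apply: cvgMr; exact: cW].
have lo : \int[@lebesgue_measure R]_(u in `[l, r]) (A + (-1) * W u) <=
    \int[@lebesgue_measure R]_(u in `[l, r]) f u.
  apply: le_Rintegral => //; [exact: integ|exact: integ|move=> u /fW].
  by rewrite ler_norml => /andP[]; lra.
have hi : \int[@lebesgue_measure R]_(u in `[l, r]) f u <=
    \int[@lebesgue_measure R]_(u in `[l, r]) (A + 1 * W u).
  apply: le_Rintegral => //; [exact: integ|exact: integ|move=> u /fW].
  by rewrite ler_norml => /andP[]; lra.
by move: lo hi; rewrite !bound ler_norml => lo hi; apply/andP; split; lra.
Qed.

(** With [Num.min] and [Num.max], [e] may lie on either side of [x], so one estimate serves both
    endpoints. The derivative bound is parametrised from [e] to [x], the shape in which strong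
    convexity supplies it. *)
Lemma Rintegral_endpoint_dist_le (R : realType) (f : R -> R) (e x c K q : R) :
  e != x -> 1 <= q -> 0 < c ->
  {within `[Num.min e x, Num.max e x], continuous f} ->
  (forall u, u \in `]Num.min e x, Num.max e x[ -> derivable f u 1) ->
  (forall t, 0 < t < 1 -> `|f^`()%classic (t * x + (1 - t) * e)| `^ q <=
    K - c * t * (1 - t) * (x - e) ^+ 2) ->
  `|\int[@lebesgue_measure R]_(u in `[Num.min e x, Num.max e x]) f u -
    f x * (Num.max e x - Num.min e x)| <=
  (x - e) ^+ 2 / 2 * (K - c * (x - e) ^+ 2 / 6) `^ (1 / q).
Proof.
move=> ex q1 c0; have q0 : 0 < q by exact: lt_le_trans q1.
set l := Num.min e x; set r := Num.max e x => cf df f'q.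
set m := K - c * (x - e) ^+ 2 / 6; set p := 1 / q.
have d0 : x - e != 0 by rewrite subr_eq0 eq_sym.
have d2 : 0 < (x - e) ^+ 2 by rewrite exprn_even_gt0.
have p0 : 0 <= p by rewrite divr_ge0// ltW.
have p01 : 0 <= p <= 1 by rewrite p0 /p ler_pdivrMr// mul1r.
have m0 : 0 < m.
  (* At the midpoint [t = 1/2] the bound gives [K >= c (x - e)^2 / 4]. *)
  have h : 0 < (1 / 2 : R) < 1 by apply/andP; split; lra.
  have := le_trans (powR_ge0 _ _) (f'q _ h).
  by have := mulr_gt0 c0 d2; rewrite /m; lra.
set k := p * m `^ p / m.
(* [P] is the tangent at [m] of [y `^ p], composed with the quadratic bound on
   [|f'|^q]; [Q' = P] and [V' = Q], with [Q e = V e = 0]. *)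
pose P (u : R) := m `^ p + k * c * ((x - e) ^+ 2 / 6 - (u - e) * (x - u)).
pose Q (u : R) := m `^ p * (u - e) +
  k * c * ((x - e) ^+ 2 / 6 * (u - e) - (x - e) / 2 * (u - e) ^+ 2
           + (u - e) ^+ 3 / 3).
pose V (u : R) := m `^ p * (u - e) ^+ 2 / 2 +
  k * c * ((x - e) ^+ 2 / 12 * (u - e) ^+ 2 - (x - e) / 6 * (u - e) ^+ 3
           + (u - e) ^+ 4 / 12).
have dQ (u : R) : is_derive u 1 Q (P u).
  by rewrite /Q /P; apply: is_derive_eq; rewrite /GRing.scale /=; field.
have dV (u : R) : is_derive u 1 V (Q u).
  by rewrite /V /Q; apply: is_derive_eq; rewrite /GRing.scale /=; field.
have f'P u : u \in `]l, r[ -> `|f^`()%classic u| <= P u.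
  move=> ulr; set t := (u - e) / (x - e).
  have ut : u = t * x + (1 - t) * e by rewrite /t; field.
  have t01 : 0 < t < 1.
    move: ulr; rewrite in_itv /= /l /r /t.
    case: (ltgtP e x) ex d0 => // ? _ _ /andP[? ?].
      by rewrite divr_gt0 ?ltr_pdivrMr ?mul1r ?subr_gt0//; lra.
    (* For [x < e] numerator and denominator of [t] are both negative. *)
    rewrite -opprB -(opprB e x) invrN mulrNN.
    by rewrite divr_gt0 ?ltr_pdivrMr ?mul1r ?subr_gt0//; lra.
  have := f'q t t01; rewrite -ut.
  have -> : c * t * (1 - t) * (x - e) ^+ 2 = c * ((u - e) * (x - u)).
    by rewrite /t; field.
  set y := `|_| `^ q => yK.
  have -> : `|f^`()%classic u| = y `^ p.
    by rewrite /y -powRrM /p mulrCA divff ?gt_eqF// mulr1 powRr1.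
  apply: (le_trans (powR_le_tangent p01 m0 (powR_ge0 _ _))).
  (* As the slope [k] is nonnegative, [y] may be replaced by its quadratic bound; subtracting [m]
     then cancels [K]. *)
  have k0 : 0 <= k by rewrite /k !mulr_ge0// ?powR_ge0// invr_ge0 ltW.
  rewrite -/k /P lerD2l -[leRHS]mulrA ler_wpM2l// /m -/y.
  by move: yK; lra.
have fQ := increment_le cf df dQ f'P.
have cQ : continuous Q.
  move=> u; apply/differentiable_continuous/derivable1_diffP.
  exact: ex_derive.
(* At [u = x] the terms in [k] vanish in [Q] (1/6 - 1/2 + 1/3 = 0) and in [V] (1/12 - 1/6 + 1/12 =
   0). *)
have VQ : V x - (x - e) * Q x = - ((x - e) ^+ 2 / 2 * m `^ p).
  by rewrite /V /Q; field.
have Ve : V e = 0 by rewrite /V subrr; field.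
have lr : l <= r by rewrite /l /r; case: (ltgtP e x) => // /ltW.
(* The bound on [|f u - f x|] is [s * (Q x - Q u)], with [s = 1] if [e < x] and [s = -1] if
   [x < e]. *)
have dW (s : R) (u : R) :
    is_derive u 1 (fun v : R => s * (Q x * v - V v)) (s * (Q x - Q u)).
  by apply: is_derive_eq; rewrite /GRing.scale /=; ring.
have cW (s : R) : continuous (fun u => s * (Q x - Q u)).
  by move=> u; apply: cvgMr; apply: cvgB; [exact: cvg_cst|exact: cQ].
have xlr : x \in `[l, r].
  by rewrite in_itv /= /l /r; case: (ltgtP e x) ex => // /ltW-> _; rewrite lexx.
have := @Rintegral_dist_le _ f _ _ l r (f x) lr cf (cW _) (dW _).
move: fQ xlr {cf df f'q f'P lr}; rewrite /l /r.
case: (ltgtP e x) ex => // _ _ fQ xlr H.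
- apply: le_trans (H 1 _) _ => [u ulr|]; last by move: VQ Ve; lra.
  by rewrite mul1r distrC fQ//; move: ulr; rewrite in_itv => /andP[].
- apply: le_trans (H (-1) _) _ => [u ulr|]; last by move: VQ Ve; lra.
  by rewrite mulN1r opprB fQ//; move: ulr; rewrite in_itv => /andP[].
Qed.

(** * Assembling the two halves of the segment *)

Theorem theorem3 (R : realType) (I : interval R) (f : R -> R) (a b q c M x : R)
  (aI : a \in I) (bI : b \in I) (ab : a < b)
  (df_int : forall u : R, [set` I]° u -> derivable f u 1)
  (df_ab : forall u : R, u \in `[a, b] -> derivable_on [set` I] f u)
  (intf' : (@lebesgue_measure R).-integrable `[a, b]
             (fun u => (derive_on [set` I] f u)%:E))
  (q1 : 1 <= q) (c0 : 0 < c)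
  (scf' : strongly_convex `[a, b] c (fun u => `|derive_on [set` I] f u| `^ q))
  (f'M : forall u : R, u \in `[a, b] -> `|derive_on [set` I] f u| <= M)
  (xab : x \in `[a, b])
  (Mq : Num.max (c * (x - a) ^+ 2 / 6) (c * (b - x) ^+ 2 / 6) <= M `^ q) :
  `| f x - 1 / (b - a) * \int[@lebesgue_measure R]_(u in `[a, b]) f u | <=
    (x - a) ^+ 2 / (2 * (b - a)) * (M `^ q - c * (x - a) ^+ 2 / 6) `^ (1 / q) +
    (b - x) ^+ 2 / (2 * (b - a)) * (M `^ q - c * (b - x) ^+ 2 / 6) `^ (1 / q).
Proof.
have subI : `[a, b] `<=` [set` I].
  exact: (interval_is_interval aI bI).
have intI u : u \in `]a, b[ -> [set` I]° u.
  suff : `]a, b[ `<=` [set` I]° by apply.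
  rewrite -open_subsetE; last exact: interval_open.
  by apply: subset_trans subI; exact: subset_itv_oo_cc.
have cf : {within `[a, b], continuous f}.
  apply/subspace_continuousP => u uab.
  have := derivable_on_continuous (df_ab _ uab).
  by apply: cvg_trans; apply: cvg_app; exact: within_subset.
have df u : u \in `]a, b[ -> derivable f u 1 by move/intI/df_int.
have f'E u : u \in `]a, b[ -> derive_on [set` I] f u = f^`()%classic u.
  by move/intI; exact: derive_on_interior.
have part e : e \in `[a, b] ->
  `|\int[@lebesgue_measure R]_(u in `[Num.min e x, Num.max e x]) f u -
    f x * (Num.max e x - Num.min e x)| <=
  (x - e) ^+ 2 / 2 * (M `^ q - c * (x - e) ^+ 2 / 6) `^ (1 / q).
  move=> eab; have q0 : 0 <= q by exact: le_trans q1.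
  have M0 u : u \in `[a, b] -> `|derive_on [set` I] f u| `^ q <= M `^ q.
    move=> /f'M uM; apply: ge0_ler_powR => //; rewrite nnegrE//.
    exact: le_trans uM.
  have exab : `[Num.min e x, Num.max e x] `<=` `[a, b].
    move=> u; move: eab xab; rewrite /= !in_itv /=.
    by case: (ltgtP e x) => _ /andP[? ?] /andP[? ?] /andP[? ?];
      apply/andP; split; lra.
  have exoo u : u \in `]Num.min e x, Num.max e x[ -> u \in `]a, b[.
    move: eab xab; rewrite !in_itv /=.
    by case: (ltgtP e x) => _ /andP[? ?] /andP[? ?] /andP[? ?];
      apply/andP; split; lra.
  have [ex|ex] := eqVneq e x.
    rewrite ex minxx maxxx.
    by rewrite set_itv1 Rintegral_set1 !subrr mulr0 subr0 normr0 expr0n !mul0r.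
  apply: Rintegral_endpoint_dist_le => // [|u /exoo/df//|t t01].
    exact: continuous_subspaceW cf.
  (* The point is strictly between [e] and [x], hence interior to [I], where [derive_on] is the
     ordinary derivative. *)
  have txe : t * x + (1 - t) * e \in `]Num.min e x, Num.max e x[.
    rewrite in_itv /=; move/andP: t01 => [t0 t1].
    case: (ltgtP e x) ex => // exlt _; apply/andP; split; rewrite -subr_gt0.
    - have -> : t * x + (1 - t) * e - e = t * (x - e) by ring.
      by rewrite mulr_gt0// subr_gt0.
    - have -> : x - (t * x + (1 - t) * e) = (1 - t) * (x - e) by ring.
      by rewrite mulr_gt0// subr_gt0.
    - have -> : t * x + (1 - t) * e - x = (1 - t) * (e - x) by ring.
      by rewrite mulr_gt0// subr_gt0.
    - have -> : e - (t * x + (1 - t) * e) = t * (e - x) by ring.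
      by rewrite mulr_gt0// subr_gt0.
  rewrite -f'E; last exact: exoo.
  (* Strong convexity between [x] and [e]; both end values are at most [M ^ q], and so is their
     convex combination. *)
  apply: (le_trans (scf' x e t xab eab t01)); rewrite lerD2r.
  rewrite [leRHS](_ : _ = t * M `^ q + (1 - t) * M `^ q); last by ring.
  move/andP: t01 => [/ltW t0 /ltW t1].
  by apply: lerD; apply: ler_wpM2l; rewrite ?subr_ge0//; exact: M0.
move: (xab); rewrite in_itv /= => /andP[ax xb].
have intab : (@lebesgue_measure R).-integrable `[a, b] (EFin \o f).
  by apply: continuous_compact_integrable => //; exact: segment_compact.
have intS : \int[@lebesgue_measure R]_(u in `[a, b]) f u =
    \int[@lebesgue_measure R]_(u in `[a, x]) f u +
    \int[@lebesgue_measure R]_(u in `[x, b]) f u.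
  (* Subtraction leaves the half-open segment from [x] to [b]; adjoining the null point [x] keeps
     its integral. *)
  have := @Rintegral_itvB _ f (BLeft a) (BRight b) x intab.
  rewrite !bnd_simp => /(_ ax xb) H.
  rewrite -(@Rintegral_itv_obnd_cbnd _ x).
    by rewrite -H addrC subrK.
  apply: integrableS intab => // u; rewrite /= !in_itv /= => /andP[xu ->].
  by rewrite andbT (le_trans ax)// ltW.
have ba : 0 < b - a by rewrite subr_gt0.
have := part a; have := part b.
rewrite !in_itv /= !lexx (ltW ab) /= => /(_ isT) Hb /(_ isT).
rewrite min_l// max_r//; move: Hb; rewrite min_r// max_l// => Hb Ha.
(* After scaling by [b - a], the deviation splits along [b - a = (x - a) + (b - x)]. *)
rewrite -(ler_pM2r ba).
have -> : `|f x - 1 / (b - a) * \int[@lebesgue_measure R]_(u in `[a, b]) f u|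
    * (b - a) =
    `|(\int[@lebesgue_measure R]_(u in `[a, x]) f u - f x * (x - a)) +
      (\int[@lebesgue_measure R]_(u in `[x, b]) f u - f x * (b - x))|.
  rewrite -{2}(gtr0_norm ba) -normrM intS -normrN; congr `|_|.
  by field; rewrite gt_eqF.
apply: (le_trans (ler_normD _ _)); apply: (le_trans (lerD Ha Hb)).
rewrite -[(x - b) ^+ 2]sqrrN opprB le_eqVlt; apply/orP; left; apply/eqP.
by field; rewrite gt_eqF.
Qed.
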